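(* Let $G$ be a connected graph containing at least one cycle. Then $g(G)\leq tr(G)$, where $g(G)$ is the girth of $G$.
   Context: All graphs are finite, simple and undirected. $d(u,v)$ denotes the usual shortest-path distance. The triameter of a connected graph $G=(V,E)$ on at least $3$ vertices is $tr(G)=\max\{d(u,v)+d(v,w)+d(u,w): u,v,w\in V\}$. The girth $g(G)$ is the length of a shortest cycle of $G$. *)

(* Defs.v *)
From mathcomp Require Import all_boot.

Set Implicit Arguments.
Unset Strict Implicit.
Unset Printing Implicit Defensive.

Section Graph.

(* A simple graph is a symmetric irreflexive relation e on a finite type T of
   vertices; these two properties are hypotheses of the theorems. *)
Variables (T : finType) (e : rel T).

Definition connected_graph : Prop := forall u v : T, connect e u v.

Definition has_walk (u v : T) (n : nat) : bool :=
  [exists p : n.-tuple T, path e u p && (last u p == v)].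

(* The entry of rank n in iota 0 m is n itself, so find returns the least n < m
   satisfying the predicate. A shortest path has fewer than #|T| edges, so dist
   takes the junk value #|T| only when v is not reachable from u. *)
Definition dist (u v : T) : nat := find (has_walk u v) (iota 0 #|T|).

Definition triameter : nat :=
  \max_(u : T) \max_(v : T) \max_(w : T) (dist u v + dist v w + dist u w).

(* ucycle accepts the empty sequence and, e being symmetric, the two ends of an
   edge; hence the requirement of at least 3 vertices. *)
Definition graph_cycle (c : seq T) : bool := (2 < size c) && ucycleb e c.

Definition has_cycle_of_length (n : nat) : bool :=
  [exists c : n.-tuple T, graph_cycle c].

(* A cycle has at most #|T| vertices, so girth takes the junk value #|T|.+1
   only on acyclic graphs. *)
Definition girth : nat := find has_cycle_of_length (iota 0 #|T|.+1).

End Graph.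

(* Main.v *)
Require Import Defs.
From mathcomp Require Import all_boot zify.

Set Implicit Arguments.
Unset Strict Implicit.
Unset Printing Implicit Defensive.

(** Two distinct simple paths with the same ends, of lengths [a] and [b],
    enclose a cycle of length at most [a + b] ([two_paths_cycle]). So a simple
    path with [a] edges, where [2 * a] is at most the girth [g], is a geodesic:
    a shorter path between its ends would give a cycle with fewer than [g] edges
    ([short_path_geodesic]).

    On a cycle with [g] vertices, the vertices of ranks 0, 1 and [uphalf g] cut
    it into arcs of lengths 1, [(uphalf g).-1] and [g./2]. None is longer than
    half the cycle, so the distances between the three vertices are these
    lengths, which add up to [g]. *)

Lemma find_iota_leq (P : pred nat) m n :
  n < m -> P n -> find P (iota 0 m) <= n.
Proof.
move=> n_lt_m Pn; rewrite leqNgt; apply/negP => /(before_find 0).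
by rewrite nth_iota // add0n Pn.
Qed.

Lemma find_iota_sat (P : pred nat) m :
  find P (iota 0 m) < m -> P (find P (iota 0 m)).
Proof.
move=> find_lt_m; have := find_lt_m; rewrite -{2}(size_iota 0 m) -has_find.
by move/(nth_find 0); rewrite nth_iota.
Qed.

Section Graph.

Variables (T : finType) (e : rel T).
Hypothesis e_sym : symmetric e.

Lemma path_rev (u v : T) (p : seq T) :
  path e u (rcons p v) = path e v (rev (u :: p)).
Proof.
rewrite -(belast_rcons u p v) -{2}(last_rcons u p v) rev_path.
by apply: eq_path => x y; rewrite e_sym.
Qed.

Lemma girth_leq (c : seq T) : graph_cycle e c -> girth e <= size c.
Proof.
move=> c_cycle; apply: find_iota_leq.
  by case/and3P: c_cycle => _ _ /card_uniqP <-; rewrite ltnS max_card.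
by apply/existsP; exists (in_tuple c).
Qed.

Lemma girth_attained (c : seq T) :
  graph_cycle e c -> exists2 d, graph_cycle e d & size d = girth e.
Proof.
move=> c_cycle; suff: has_cycle_of_length e (girth e).
  by case/existsP => d d_cycle; exists d; rewrite ?size_tuple.
apply: (@find_iota_sat _ #|T|.+1); apply: leq_ltn_trans (girth_leq c_cycle) _.
by case/and3P: c_cycle => _ _ /card_uniqP <-; rewrite ltnS max_card.
Qed.

(** The cycle follows the first path up to its first vertex [z] on the second
    path and comes back along the second; it has at least 3 vertices because
    the paths leave [u] along different edges. *)
Lemma forked_paths_cycle (u x y : T) (p q : seq T) :
    path e u (x :: p) -> path e u (y :: q) ->
    uniq (u :: x :: p) -> uniq (u :: y :: q) ->
    last x p = last y q -> x != y ->
  exists2 c, graph_cycle e c & size c <= size (x :: p) + size (y :: q).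
Proof.
move=> p_path q_path p_uniq q_uniq last_eq x_neq_y.
have meet : has (mem (y :: q)) (x :: p).
  by apply/hasP; exists (last x p); [|rewrite last_eq]; apply: mem_last.
have x_head : ohead (x :: p) = Some x by [].
have y_head : ohead (y :: q) = Some y by [].
move: (x :: p) (y :: q) p_path q_path p_uniq q_uniq meet x_head y_head
  => {last_eq}P Q P_path Q_path P_uniq Q_uniq meet.
case: (split_find meet) P_path P_uniq => z p1 p2 /= z_in_Q p1_disj.
case: (splitPr z_in_Q) Q_path Q_uniq p1_disj => q1 q2.
rewrite -!cat_rcons !cat_path => /andP[q1_path _] Q_uniq p1_disj
  /andP[p1_path _] P_uniq x_head y_head.
exists (u :: p1 ++ z :: rev q1); last first.
  by rewrite /= !(size_cat, size_rcons) /= size_rev; lia.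
have p1_q1 : 0 < size p1 + size q1.
  case: p1 q1 x_head y_head {p1_path q1_path P_uniq Q_uniq p1_disj meet z_in_Q}
    => [|? ?] [|? ?] //= [z_x] [z_y].
  by rewrite -z_x -z_y eqxx in x_neq_y.
apply/and3P; split; first by rewrite /= size_cat /= size_rev addnS.
  rewrite /= -cat_rcons rcons_cat cat_path p1_path last_rcons /=.
  by rewrite -rev_cons -path_rev.
move: P_uniq Q_uniq p1_disj.
rewrite !cat_rcons /= !cat_uniq /= !mem_cat !inE !negb_or mem_rev.
rewrite !rev_uniq => /andP[/and3P[-> -> _] /and3P[-> /andP[z_p1 _] _]].
move=> /andP[/and3P[-> _ _] /and3P[-> /andP[z_q1 _] _]] /= p1_disj.
rewrite mem_rev z_p1 z_q1 !andbT /=.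
apply/hasPn => t; rewrite mem_rev => t_q1; apply/negP => t_p1.
by case/hasP: p1_disj; exists t => //; rewrite inE mem_cat t_q1.
Qed.

(** Neither path is empty, since a simple path does not come back to [u];
    dropping their common initial edges leaves two paths that fork at once. *)
Lemma two_paths_cycle (u : T) (p q : seq T) :
    path e u p -> path e u q -> uniq (u :: p) -> uniq (u :: q) ->
    last u p = last u q -> p != q ->
  exists2 c, graph_cycle e c & size c <= size p + size q.
Proof.
elim: p u q => [|x p IHp] u [|y q] //.
- move=> _ _ _ /andP[u_notin _] /= u_last.
  by rewrite u_last mem_last in u_notin.
- move=> _ _ /andP[u_notin _] _ /= u_last.
  by rewrite -u_last mem_last in u_notin.
have [<-|x_neq_y] := eqVneq x y; last first.
  by move=> p_path q_path p_uniq q_uniq last_eq _; apply: (@forked_paths_cycle u).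
move=> /andP[_ p_path] /andP[_ q_path] /andP[_ p_uniq] /andP[_ q_uniq] last_eq.
rewrite eqseq_cons eqxx /= => p_neq_q.
have [c c_cycle c_size] := IHp x q p_path q_path p_uniq q_uniq last_eq p_neq_q.
by exists c => //; apply: leq_trans c_size _; rewrite /=; lia.
Qed.

Lemma short_path_geodesic (u : T) (p : seq T) :
    path e u p -> uniq (u :: p) -> (size p).*2 <= girth e ->
  size p <= dist e u (last u p).
Proof.
move=> p_path p_uniq p_short; set v := last u p.
rewrite leqNgt; apply/negP => dist_lt.
have p_card : size p < #|T|.
  by rewrite -[(size p).+1]/(size (u :: p)) -(card_uniqP p_uniq) max_card.
have /existsP[q /andP[q_path /eqP q_last]] : has_walk e u v (dist e u v).
  by apply: find_iota_sat; apply: ltn_trans p_card.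
(* the walk that realizes the distance is made simple by removing its loops *)
case/shortenP: q_path q_last => r r_path r_uniq r_sub r_last.
have r_size : size r < size p.
  apply: leq_ltn_trans dist_lt; rewrite -(size_tuple q).
  by apply: uniq_leq_size r_sub; case/andP: r_uniq.
have p_neq_r : p != r by apply: contraTneq r_size => ->; rewrite ltnn.
have [c /girth_leq c_girth c_size] :=
  two_paths_cycle p_path r_path p_uniq r_uniq (esym r_last) p_neq_r.
have := leq_trans p_short (leq_trans c_girth c_size).
by rewrite -addnn leq_add2l leqNgt r_size.
Qed.

Lemma leq_triameter (u v w : T) :
  dist e u v + dist e v w + dist e u w <= triameter e.
Proof.
apply: leq_trans (leq_bigmax u); apply: leq_trans (leq_bigmax v).
exact: (leq_bigmax w).
Qed.

End Graph.

Theorem theorem3p6 (T : finType) (e : rel T)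
  (e_sym : symmetric e) (e_irr : irreflexive e)
  (e_conn : connected_graph e)
  (e_cyc : exists c : seq T, graph_cycle e c) :
  girth e <= triameter e.
Proof.
case: e_cyc => c0 /girth_attained[c c_cycle c_size].
case: c c_size c_cycle => [|u [|v s]] // c_size /and3P[c_gt2 c_path c_uniq].
set h := uphalf (girth e).
(* the third vertex has rank h on the cycle, hence rank h - 2 in s *)
have h_lt : h.-2 < size s by move: c_gt2 c_size; rewrite /h /=; lia.
pose w := nth u s h.-2.
have s_split : s = take h.-2 s ++ w :: drop h.-2.+1 s.
  by rewrite -drop_nth // cat_take_drop.
have s1_size : size (take h.-2 s) = h.-2 by rewrite size_takel // ltnW.
have s2_size : size (drop h.-2.+1 s) = size s - h.-2.+1 by rewrite size_drop.
move: (take _ _) (drop _ _) s_split s1_size s2_size => s1 s2 s_split.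
move=> s1_size s2_size.
have : [&& e u v, path e v (rcons s1 w) & path e w (rcons s2 u)].
  move: c_path; rewrite /= s_split rcons_cat -cat_rcons cat_path last_rcons.
  by [].
rewrite (path_rev e_sym w u) => /and3P[uv_edge s1_path s2_path].
have [s1_uniq s2_uniq] : uniq (v :: rcons s1 w) /\ uniq (u :: rev (w :: s2)).
  rewrite s_split in c_uniq; split.
    move: c_uniq; rewrite -cat_rcons cons_uniq -cat_cons cat_uniq.
    by case/and3P.
  move: c_uniq; rewrite cons_uniq -cat_cons cat_uniq mem_cat negb_or.
  case/andP=> /andP[_ u_s2] /and3P[_ _ s2_uniq].
  by rewrite cons_uniq rev_uniq mem_rev u_s2.
(* the three arcs are simple paths to which [short_path_geodesic] applies, since
   1, h - 1 and girth - h are at most half the girth *)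
have uv_path : path e u [:: v] by rewrite /= uv_edge.
have uv_uniq : uniq [:: u; v].
  by move: c_uniq; rewrite /= !inE negb_or andbT => /andP[/andP[]].
have := short_path_geodesic e_sym uv_path uv_uniq.
have := short_path_geodesic e_sym s1_path s1_uniq.
have := short_path_geodesic e_sym s2_path s2_uniq.
rewrite rev_cons !last_rcons !size_rcons size_rev s1_size s2_size /=.
have := leq_triameter e u v w.
move: c_gt2 c_size h_lt; rewrite /h /=; lia.
Qed.
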